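(* Let $G$ be a simple graph of order $n$ with chromatic number $\chi$ satisfying $3\le \chi\le n-1$, and let $\lambda_n$ be the least eigenvalue of the adjacency matrix of $G$. Then \[ \lambda_n \ge -\frac{n-\chi+2+\sqrt{(n-\chi-2)^2+4\chi(n-\chi)}}{4}, \] with equality if and only if both $n$ and $\chi$ are even and $G \cong \left(K_{\chi/2}\cup\tfrac{n-\chi}{2}K_1\right) \vee \left(K_{\chi/2}\cup\tfrac{n-\chi}{2}K_1\right)$.
   Context: $K_k$ denotes the complete graph on $k$ vertices and $kK_1$ the edgeless graph on $k$ vertices. For vertex-disjoint graphs $H_1,H_2$, $H_1\cup H_2$ is their disjoint union, and $H_1\vee H_2$ is their join: the disjoint union together with all edges joining every vertex of $H_1$ to every vertex of $H_2$. *)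

(* Defs.v *)
From mathcomp Require Import all_boot all_order all_algebra.
From mathcomp Require Import reals.

Set Implicit Arguments.
Unset Strict Implicit.
Unset Printing Implicit Defensive.

Import Order.TTheory GRing.Theory Num.Theory.
Local Open Scope ring_scope.

Record sgraph := SGraph {
  vertex :> finType;
  edge : rel vertex;
  edge_sym : symmetric edge;
  edge_irr : irreflexive edge
}.

Definition isomorphic (G H : sgraph) : Prop :=
  exists2 f : G -> H, bijective f & forall x y, edge (f x) (f y) = edge x y.

Section Constructions.

Definition complete_edge (k : nat) : rel 'I_k := fun x y => x != y.

Lemma complete_edge_sym k : symmetric (@complete_edge k).
Proof. by move=> x y; rewrite /complete_edge eq_sym. Qed.

Lemma complete_edge_irr k : irreflexive (@complete_edge k).
Proof. by move=> x; rewrite /complete_edge eqxx. Qed.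

Definition complete (k : nat) : sgraph :=
  SGraph (@complete_edge_sym k) (@complete_edge_irr k).

Definition edgeless_edge (k : nat) : rel 'I_k := fun _ _ => false.

Lemma edgeless_edge_sym k : symmetric (@edgeless_edge k).
Proof. by []. Qed.

Lemma edgeless_edge_irr k : irreflexive (@edgeless_edge k).
Proof. by []. Qed.

Definition edgeless (k : nat) : sgraph :=
  SGraph (@edgeless_edge_sym k) (@edgeless_edge_irr k).

Variables G H : sgraph.

(* [cross] says whether vertices of different summands are adjacent: it is
   [false] for the disjoint union and [true] for the join. *)
Definition sum_edge (cross : bool) : rel (G + H)%type := fun u v =>
  match u, v with
  | inl x, inl y => edge x y
  | inr x, inr y => edge x y
  | _, _ => cross
  end.

Lemma sum_edge_sym cross : symmetric (sum_edge cross).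
Proof. by case=> x [] y //=; rewrite edge_sym. Qed.

Lemma sum_edge_irr cross : irreflexive (sum_edge cross).
Proof. by case=> x /=; rewrite edge_irr. Qed.

Definition disjoint_union : sgraph :=
  SGraph (sum_edge_sym false) (sum_edge_irr false).

Definition join : sgraph :=
  SGraph (sum_edge_sym true) (sum_edge_irr true).

End Constructions.

Definition colorable (G : sgraph) (k : nat) : bool :=
  [exists c : {ffun G -> 'I_k}, forall x, forall y, edge x y ==> (c x != c y)].

Lemma colorable_order (G : sgraph) : exists k, colorable G k.
Proof.
exists #|G|; apply/existsP; exists [ffun x => enum_rank x].
apply/forallP=> x; apply/forallP=> y; apply/implyP=> xy; rewrite !ffunE.
by apply: contraTneq xy => /enum_rank_inj->; rewrite edge_irr.
Qed.

Definition chromatic_number (G : sgraph) : nat := ex_minn (colorable_order G).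

Definition adjacency (R : realType) (G : sgraph) : 'M[R]_#|G| :=
  \matrix_(i, j) (edge (enum_val i) (enum_val j))%:R.

Definition least_eigenvalue (R : realType) (m : nat) (A : 'M[R]_m) (a : R) :
  Prop := eigenvalue A a /\ forall b, eigenvalue A b -> a <= b.

(* Main.v *)
Require Import Defs.
From mathcomp Require Import all_boot all_order all_algebra.
From mathcomp Require Import reals boolp.
From mathcomp Require Import ring lra zify.

Set Implicit Arguments.
Unset Strict Implicit.
Unset Printing Implicit Defensive.

Import Order.TTheory GRing.Theory Num.Theory.
Local Open Scope ring_scope.

(** Let [x] be an eigenvector for the eigenvalue [r] and let [mu] be minus the
    claimed bound. Split the vertices by the sign of [x]; the two parts need [a] and
    [b] colours with [a + b = chi]. With nonnegative weights, a graph needing [a]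
    colours has at least the edge weight of a clique on its [a] lightest vertices, so
    each part may be replaced by a clique plus isolated vertices. If a part has [a]
    clique vertices, [p] isolated ones and total weight [S], completing the square
    bounds its energy (edge weight plus [mu] times the squared norm) below by
    [S ^+ 2 / f] where [f = a / (a + mu - 1) + p / mu]. Hence
    [(r + mu) * |x| ^+ 2 >= S ^+ 2 / f + T ^+ 2 / g - 2 * S * T], which is
    nonnegative because [f + g <= 2]: the map [a |-> a / (a + mu - 1)] is concave and
    [mu] is the value making [f + g = 2] for equal cliques. Equality forces [a = b],
    equally many isolated vertices, all cross edges, and weights that are constant on
    the clique vertices and on the strictly heavier isolated ones. *)

(** * Colourings of vertex lists and the split of the chromatic number *)

Section ColoringLists.

Variable G : sgraph.
Implicit Types (s t : seq G) (k a : nat).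

(** The colouring is a function on all of [G] constrained only on [s], so lists can grow and shrink
    without induced subgraph types. *)
Definition seq_colorable s k : Prop :=
  exists2 c : G -> nat, {in s, forall u, (c u < k)%N} &
    {in s &, forall u w, edge u w -> c u <> c w}.

(** Only a lower bound on the chromatic number of the part: after the split below, [t] may need more
    than [b] colours. *)
Definition needs_colors s a : Prop :=
  forall k, (k < a)%N -> ~ seq_colorable s k.

Lemma seq_colorable_size s : seq_colorable s (size s).
Proof.
exists (fun u => index u s) => [u|u w us ws uw]; first by rewrite index_mem.
move=> /(congr1 (nth u s)); rewrite !nth_index // => uw'.
by move: uw; rewrite uw' edge_irr.
Qed.

Lemma needs_colors_size s a : needs_colors s a -> (a <= size s)%N.
Proof.
move=> sa; rewrite leqNgt; apply/negP => /sa; apply; exact: seq_colorable_size.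
Qed.

Lemma seq_colorable_cons v s k : seq_colorable s k -> seq_colorable (v :: s) k.+1.
Proof.
move=> [c ck cs]; exists (fun u => if u == v then k else c u) => [u|u w].
  by rewrite inE; case: eqVneq => //= _ /ck /ltnW.
rewrite !inE; case: (eqVneq u v) => [->|uv]; case: (eqVneq w v) => [->|wv] //=.
- by rewrite edge_irr.
- by move=> _ /ck + _ => /[swap] <-; rewrite ltnn.
- by move=> /ck + _ _ => /[swap] ->; rewrite ltnn.
- exact: cs.
Qed.

(** A colour absent from the neighbours of [v] could be given to [v], so all [k] colours occur among
    them. *)
Lemma neighbors_per_color v s k :
    seq_colorable s k -> ~ seq_colorable (v :: s) k ->
  (k <= size [seq u <- s | edge v u])%N.
Proof.
move=> [c ck cs] vsk; rewrite -(size_iota 0 k) -(size_map c).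
apply: uniq_leq_size (iota_uniq _ _) _ => j; rewrite mem_iota /= add0n => jk.
apply: contrapT => /negP jN; apply: vsk.
have cN u : u \in s -> edge v u -> c u <> j.
  move=> us vu cuj; case/negP: jN; apply/mapP; exists u => //.
  by rewrite mem_filter vu.
exists (fun u => if u == v then j else c u) => [u|u w].
  by rewrite inE; case: eqVneq => //= _ /ck.
rewrite !inE; case: (eqVneq u v) => [->|uv]; case: (eqVneq w v) => [->|wv] //=.
- by rewrite edge_irr.
- by move=> _ ws vw /esym; apply: cN.
- by move=> us _; rewrite edge_sym; apply: cN.
- exact: cs.
Qed.

Lemma seq_colorable_colorable s t k l :
    (forall u, (u \in s) || (u \in t)) ->
  seq_colorable s k -> seq_colorable t l -> colorable G (k + l).
Proof.
move=> st [c ck cs] [d dl dt].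
pose e u := if u \in s then c u else (k + d u)%N.
have ekl u : (e u < k + l)%N.
  rewrite /e; have := st u; case: ifP => [us _|_ /= ut].
    by rewrite (leq_trans (ck _ us)) ?leq_addr.
  by rewrite ltn_add2l dl.
apply/existsP; exists [ffun u => Ordinal (ekl u)].
apply/forallP => u; apply/forallP => w; apply/implyP => uw; rewrite !ffunE.
apply/eqP => /(congr1 val) /=; rewrite /e.
have := st u; have := st w; case: ifP => us; case: ifP => ws //=.
- by move=> _ _; apply: cs.
- by move=> _ _ E; have := ck _ us; rewrite E -ltn_subRL subnn ltn0.
- by move=> _ _ E; have := ck _ ws; rewrite -E -ltn_subRL subnn ltn0.
- by move=> wt ut /addnI; apply: dt.
Qed.

(** [a] is the chromatic number of the part [s]. Fewer than [m - a] colours on [t], taken from a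
    disjoint palette, would colour [G] with fewer than [m]. *)
Lemma needs_colors_split s t :
    (forall u, (u \in s) || (u \in t)) ->
  exists a b, [/\ (a + b)%N = chromatic_number G,
    needs_colors s a & needs_colors t b].
Proof.
move=> st; rewrite /chromatic_number; case: ex_minnP => m _ mmin.
have [a [am sa ae]] : exists a, [/\ (a <= m)%N, needs_colors s a &
    a = m \/ seq_colorable s a].
  (* A search stopped at [m]: either nothing below [j] colours [s], or the least number of colours
     has been found. *)
  suff: forall j, (j <= m)%N -> exists a, [/\ (a <= m)%N, needs_colors s a &
     (a = j \/ seq_colorable s a)] by apply.
  elim=> [_|j IH jm]; first by exists 0%N; split => //; left.
  have [a [am sa [aj|aC]]] := IH (ltnW jm); last by exists a; split=> //; right.
  case: (EM (seq_colorable s a)) => aC; first by exists a; split=> //; right.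
  exists a.+1; split; rewrite ?aj //; last by left.
  move=> k; rewrite ltnS leq_eqVlt => /orP[/eqP->|]; first by rewrite -aj.
  by rewrite -aj => /sa.
exists a, (m - a)%N; split=> //; first by rewrite subnKC.
move=> k km tk; case: ae => [ae|sC]; first by move: km; rewrite ae subnn.
have /mmin := seq_colorable_colorable st sC tk.
by rewrite leqNgt -ltn_subRL km.
Qed.

End ColoringLists.

(** * Edge weight compared with a clique on the lightest vertices *)

Section WeightedEdges.

Variables (R : realType) (G : sgraph).
Implicit Types (s t : seq G) (y : G -> R) (a m : nat).

(** Ordered pairs, so each edge counts twice: the quadratic form of the adjacency matrix. *)
Definition edge_sum y s : R :=
  \sum_(u <- s) \sum_(w <- s) (edge u w)%:R * (y u * y w).

(** The same form for a complete graph on [s]: the squared sum without its diagonal. *)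
Definition clique_sum y s : R :=
  (\sum_(u <- s) y u) ^+ 2 - \sum_(u <- s) y u ^+ 2.

Definition ascending y s : bool := pairwise (fun u w => y u <= y w) s.

Lemma edge_sum_cons y v s :
  edge_sum y (v :: s) = 2 * (y v * \sum_(u <- s | edge v u) y u) + edge_sum y s.
Proof.
rewrite /edge_sum big_cons big_cons edge_irr mul0r add0r.
under [X in _ + X]eq_bigr => u _ do rewrite big_cons.
rewrite big_split /=.
rewrite addrA mulrDl mul1r; congr (_ + _); congr (_ + _).
  rewrite big_distrr /= [RHS]big_mkcond /=; apply: eq_bigr => u _.
  by case: (edge v u); rewrite ?mul1r ?mul0r.
rewrite big_distrr /= [RHS]big_mkcond /=; apply: eq_bigr => u _.
by rewrite edge_sym; case: (edge v u); rewrite ?mul1r ?mul0r // mulrC.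
Qed.

Lemma clique_sum_cons y v s :
  clique_sum y (v :: s) = 2 * (y v * \sum_(u <- s) y u) + clique_sum y s.
Proof. by rewrite /clique_sum !big_cons; ring. Qed.

Lemma clique_sum_rcons y v s :
  clique_sum y (rcons s v) = 2 * (y v * \sum_(u <- s) y u) + clique_sum y s.
Proof. by rewrite /clique_sum !big_rcons /=; ring. Qed.

(** When [p] rejects the head, the window shifts up by one; the entry gained is at least as heavy as
    the head lost. *)
Lemma sum_take_le_filter y (p : pred G) s m :
    ascending y s -> {in s, forall u, 0 <= y u} ->
    (m <= size [seq u <- s | p u])%N ->
  \sum_(u <- take m s) y u <= \sum_(u <- s | p u) y u.
Proof.
elim: s m => [|v s IH] [|m]; rewrite ?big_nil //.
  by move=> _ y0 _; rewrite big_seq_cond sumr_ge0 // => u /andP[/y0].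
rewrite /ascending /= => /andP[/allP vs ys] y0.
have y0' : {in s, forall u, 0 <= y u} by move=> u us; rewrite y0 // inE us orbT.
rewrite !big_cons; case: (p v) => /= pm; first by rewrite lerD2l IH.
apply: le_trans (IH m.+1 ys y0' pm).
have ms : (m < size s)%N by rewrite (leq_trans pm) // size_filter count_size.
rewrite (take_nth v) // -cats1 big_cat big_seq1 /= [leRHS]addrC lerD2r vs ?mem_nth //.
Qed.

(* Delete the lightest vertex. If the number of colours needed does not drop,
   the window of the [a] lightest vertices shifts upwards; otherwise that vertex
   sees every colour of the rest, hence at least [a - 1] vertices. *)
Lemma clique_sum_le_edge_sum y s a :
    ascending y s -> {in s, forall u, 0 <= y u} -> needs_colors s a ->
  clique_sum y (take a s) <= edge_sum y s.
Proof.
elim: s a => [|v s IH] a; first by rewrite /clique_sum /edge_sum !big_nil expr0n subr0.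
move=> ys' y0' sa'; have y0 : {in s, forall u, 0 <= y u}.
  by move=> u us; rewrite y0' // inE us orbT.
have /y0' yv : v \in v :: s by rewrite mem_head.
have N0 : 0 <= \sum_(u <- s | edge v u) y u.
  by rewrite big_seq_cond sumr_ge0 // => u /andP[/y0].
move: (ys'); rewrite /ascending /= => /andP[/allP vs ys].
rewrite edge_sum_cons; case: a sa' => [|a] sa'.
  rewrite take0 {1}/clique_sum !big_nil expr0n subr0 addr_ge0 //.
    by rewrite !mulr_ge0.
  apply: le_trans (IH 0%N ys y0 _) => //; rewrite take0.
  by rewrite /clique_sum !big_nil expr0n subr0.
rewrite /= clique_sum_cons; case: (EM (needs_colors s a.+1)) => [sa|nsa].
  have as' := needs_colors_size sa.
  apply: le_trans (lerD (mulr_ge0 _ (mulr_ge0 yv N0)) (IH _ ys y0 sa)) => //.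
  rewrite (take_nth v) // clique_sum_rcons add0r lerD2r ler_pM2l //.
  rewrite ler_wpM2r ?vs ?mem_nth // big_seq sumr_ge0 // => u /mem_take; exact: y0.
have sa : needs_colors s a.
  by move=> k ka /(seq_colorable_cons v); apply: sa'.
have sC : seq_colorable s a.
  apply: contrapT => sC; apply: nsa => k; rewrite ltnS leq_eqVlt.
  by case/orP => [/eqP->|/sa].
rewrite lerD ?IH // ler_pM2l // ler_wpM2l // sum_take_le_filter //.
by apply: neighbors_per_color sC _; apply: sa'.
Qed.

Lemma clique_sum_const y s (l : R) :
  {in s, forall u, y u = l} -> clique_sum y s = (size s)%:R * ((size s)%:R - 1) * l ^+ 2.
Proof.
move=> yl; have y2l : {in s, forall u, y u ^+ 2 = l ^+ 2} by move=> u /yl->.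
rewrite /clique_sum (eq_big_seq _ yl) (eq_big_seq _ y2l) !big_const_seq.
by rewrite !count_predT !iter_addr_0 -(mulr_natr l) -(mulr_natr (l ^+ 2)); ring.
Qed.

(* Every edge weighs at least [l ^+ 2], and there are at least as many edges as in
   the clique: equality of the weights leaves no choice. *)
Lemma edge_sum_min_edges y s a (l h : R) :
    uniq s -> needs_colors s a -> 0 < l -> l < h ->
    {in take a s, forall u, y u = l} -> {in drop a s, forall u, y u = h} ->
    edge_sum y s <= clique_sum y (take a s) ->
  {in s &, forall u w,
    edge u w = [&& u != w, u \in take a s & w \in take a s]}.
Proof.
move=> us sa l0 lh yl yh Es.
have as_ := needs_colors_size sa.
have sz : size (take a s) = a by rewrite size_takel.
have mem_s u : (u \in s) = (u \in take a s) || (u \in drop a s).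
  by rewrite -mem_cat cat_take_drop.
have ylE u : u \in s -> l <= y u.
  by rewrite mem_s => /orP[/yl->|/yh->] //; exact: ltW.
(* Unit weights turn the clique bound into a count of ordered adjacent pairs. *)
have cnt : a%:R * (a%:R - 1) <= \sum_(u <- s) \sum_(w <- s) (edge u w)%:R :> R.
  have := @clique_sum_le_edge_sum (fun=> 1) s a _ _ sa.
  rewrite (@clique_sum_const _ _ 1) // sz expr1n mulr1 /edge_sum.
  under [X in _ -> _ -> _ <= X]eq_bigr => u _ do
    under eq_bigr => w _ do rewrite !mulr1.
  apply=> //; rewrite /ascending; clear; by elim: s => //= v s ->; rewrite andbT; apply/allP.
have light : {in s &, forall u w, edge u w -> (u \in take a s) && (w \in take a s)}.
  have term_ge0 u w : u \in s -> w \in s ->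
      0 <= (edge u w)%:R * (y u * y w - l ^+ 2).
    move=> /ylE yu /ylE yw; rewrite mulr_ge0 // subr_ge0 expr2.
    by rewrite ler_pM // ltW.
  (* [Es] and [cnt] make this sum of nonnegative terms nonpositive, so every edge weighs exactly
     [l ^+ 2] and avoids the heavy vertices. *)
  have : \sum_(u <- s) \sum_(w <- s) (edge u w)%:R * (y u * y w - l ^+ 2) <= 0.
    under eq_bigr => u _ do under eq_bigr => w _ do rewrite mulrBr.
    under eq_bigr => u _ do rewrite sumrB -mulr_suml.
    rewrite sumrB -mulr_suml subr_le0; apply: le_trans Es _.
    rewrite (clique_sum_const yl) sz; apply: ler_wpM2r cnt; exact: sqr_ge0.
  rewrite big_seq => le0 u w us' ws uw.
  have inner_ge0 v : v \in s ->
      0 <= \sum_(w <- s) (edge v w)%:R * (y v * y w - l ^+ 2).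
    by move=> vs; rewrite big_seq sumr_ge0 // => *; apply: term_ge0.
  have eq0 : \sum_(u <- s | u \in s)
      \sum_(w <- s) (edge u w)%:R * (y u * y w - l ^+ 2) == 0.
    by rewrite eq_le le0 sumr_ge0.
  move: eq0; rewrite psumr_eq0 // => /allP/(_ _ us'); rewrite us' /=.
  rewrite big_seq psumr_eq0; last by move=> *; apply: term_ge0.
  move=> /allP/(_ _ ws); rewrite ws uw mul1r /= => /eqP E.
  have heavy v w' : v \in drop a s -> w' \in s -> y v * y w' <> l ^+ 2.
    move=> /yh-> /ylE lw; have : l * l < h * y w' by nra.
    by rewrite -expr2 => /[swap] ->; rewrite ltxx.
  have {}E : y u * y w = l ^+ 2 by apply/eqP; rewrite -subr_eq0 E.
  move: (us') (ws); rewrite !mem_s => /orP[->|ud]; last by case: (heavy u w).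
  by move=> /orP[->|wd] //; case: (heavy w u); rewrite // mulrC.
have lightsum : \sum_(u <- s) \sum_(w <- s) (edge u w)%:R =
   \sum_(u <- take a s) \sum_(w <- take a s) (edge u w)%:R :> R.
  rewrite -{1}(cat_take_drop a s) big_cat /= addrC big_seq big1 ?add0r.
    apply: eq_big_seq => u ut; rewrite -{1}(cat_take_drop a s) big_cat /=.
    rewrite addrC big_seq big1 ?add0r // => w wd.
    case uw: (edge u w) => //; exfalso.
    have := light _ _ (mem_take ut) (mem_drop wd) uw => /andP[_ wt].
    by have := yl _ wt; rewrite (yh _ wd); lra.
  move=> u ud; rewrite big_seq big1 // => w ws.
  case uw: (edge u w) => //; exfalso.
  have := light _ _ (mem_drop ud) ws uw => /andP[ut _].
  by have := yl _ ut; rewrite (yh _ ud); lra.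
have ut : uniq (take a s) by rewrite take_uniq.
have cliquesum : \sum_(u <- take a s) \sum_(w <- take a s) (u != w)%:R =
    a%:R * (a%:R - 1) :> R.
  rewrite (eq_big_seq (fun=> a%:R - 1)) => [|u us'].
    by rewrite big_const_seq count_predT iter_addr_0 sz -[LHS]mulr_natl.
  under eq_bigr => w _ do rewrite -[(u != w)%:R](addrK (u == w)%:R).
  rewrite sumrB; congr (_ - _).
    rewrite (eq_bigr (fun=> 1)) => [|w _]; last by case: eqP; rewrite ?add0r ?addr0.
    by rewrite big_const_seq count_predT iter_addr_0 sz.
  rewrite (bigD1_seq u) //= eqxx big1 ?addr0 // => w; rewrite eq_sym.
  by move=> /negPf->.
(* All edges lie inside [take a s], and [cnt] demands as many as a complete graph has there. *)
have clique : {in take a s &, forall u w, edge u w = (u != w)}.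
  have term_ge0 (u w : G) : 0 <= (u != w)%:R - (edge u w)%:R :> R.
    by case: eqVneq => [->|_]; rewrite ?edge_irr ?subrr //; case: edge; rewrite ?subrr ?subr0.
  have : \sum_(u <- take a s) \sum_(w <- take a s)
      ((u != w)%:R - (edge u w)%:R) == 0 :> R.
    rewrite eq_le; apply/andP; split; last by do 2!apply: sumr_ge0 => ? _.
    under eq_bigr => u _ do rewrite sumrB.
    by rewrite sumrB subr_le0 cliquesum -lightsum.
  rewrite psumr_eq0; last by move=> *; apply: sumr_ge0.
  move=> /allP H u w us' ws; have := H _ us'; rewrite /= psumr_eq0 //.
  move=> /allP/(_ _ ws) /=; rewrite subr_eq0 eqr_nat.
  by case: (u != w); case: (edge u w).
move=> u w us' ws; case: (boolP (_ && (w \in _))) => [/andP[ut' wt]|nl].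
  by rewrite andbT clique.
by rewrite andbF; apply/negbTE; apply: contra nl; apply: light.
Qed.

End WeightedEdges.

(** * Energy of one part and the combination of two parts *)

Section Energy.

Variable R : realType.

(** The sum of the entries of [(A + mu I)^-1] for a clique on [a] vertices plus [p] isolated ones;
    its inverse is the least energy at total weight 1. *)
Definition part_weight (mu : R) (a p : R) : R := a / (a + mu - 1) + p / mu.

Lemma part_weight_ge0 (mu : R) (a p : nat) :
  1 < mu -> 0 <= part_weight mu a%:R p%:R.
Proof.
move=> mu1; have a0 : 0 <= a%:R :> R by []. have p0 : 0 <= p%:R :> R by [].
by rewrite addr_ge0 // divr_ge0 //; lra.
Qed.

Lemma part_weight_eq0 (mu : R) (a p : nat) :
  1 < mu -> part_weight mu a%:R p%:R = 0 -> a = 0%N /\ p = 0%N.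
Proof.
move=> mu1; have a0 : 0 <= a%:R :> R by []. have p0 : 0 <= p%:R :> R by [].
have w0 : 0 < a%:R + mu - 1 by lra.
have m0 : 0 < mu by lra.
have aw0 := divr_ge0 a0 (ltW w0); have pm0 := divr_ge0 p0 (ltW m0).
move/eqP; rewrite /part_weight paddr_eq0 // !mulf_eq0 !invr_eq0.
by rewrite !pnatr_eq0 (gt_eqF w0) (gt_eqF m0) !orbF => /andP[/eqP-> /eqP->].
Qed.

(* The condition on [mu] says that two equal parts have weight 1 each; the error
   term measures the concavity of [a / (a + mu - 1)] in [a]. *)
Lemma part_weightD (mu a b p q : R) :
    1 < mu -> 0 <= a -> 0 <= b ->
    4 * mu ^+ 2 - (4 + 2 * (p + q)) * mu - (p + q) * (a + b - 2) = 0 ->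
  part_weight mu a p + part_weight mu b q =
  2 - (mu - 1) * (a - b) ^+ 2 /
      ((a + mu - 1) * (b + mu - 1) * (a + b + 2 * mu - 2)).
Proof.
move=> mu1 a0 b0 mu_eq.
have A0 : a + mu - 1 != 0 by rewrite gt_eqF //; lra.
have B0 : b + mu - 1 != 0 by rewrite gt_eqF //; lra.
have C0 : a + b + 2 * mu - 2 != 0 by rewrite gt_eqF //; lra.
have m0 : mu != 0 by rewrite gt_eqF //; lra.
(* With both clique sizes replaced by their mean, [mu_eq] makes the weights sum to exactly 2. *)
have mid : 2 * (a + b) / (a + b + 2 * mu - 2) + (p + q) / mu = 2.
  apply/eqP; rewrite -subr_eq0; apply/eqP.
  rewrite [LHS](_ : _ = - (4 * mu ^+ 2 - (4 + 2 * (p + q)) * mu -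
    (p + q) * (a + b - 2)) / ((a + b + 2 * mu - 2) * mu)).
    by rewrite mu_eq oppr0 mul0r.
  by field; rewrite m0 C0.
rewrite -{1}mid /part_weight; field.
by rewrite m0 A0 B0 C0.
Qed.

(** [f + g <= 2] gives [f * g <= 1], which makes the form positive semidefinite. The implications at
    weight zero cover an empty part, where division by zero yields 0. *)
Lemma weighted_squares_ge0 (f g S T : R) :
    0 <= f -> 0 <= g -> f + g <= 2 -> (f = 0 -> S = 0) -> (g = 0 -> T = 0) ->
  0 <= S ^+ 2 / f + T ^+ 2 / g - 2 * S * T.
Proof.
move=> f0 g0 fg fS gT.
case: (eqVneq f 0) => [fE|fN0].
  by rewrite fS // expr0n mul0r add0r mulr0 mul0r subr0 divr_ge0 ?sqr_ge0.
case: (eqVneq g 0) => [gE|gN0].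
  by rewrite gT // expr0n mul0r addr0 mulr0 subr0 divr_ge0 ?sqr_ge0.
have fp : 0 < f by rewrite lt_neqAle eq_sym fN0.
have gp : 0 < g by rewrite lt_neqAle eq_sym gN0.
rewrite [leRHS](_ : _ = ((g * S - f * g * T) ^+ 2 + f * g * (1 - f * g) * T ^+ 2)
   / (f * g ^+ 2)); last by field; rewrite fN0 gN0.
have fg_ge0 := mulr_ge0 f0 g0; apply: divr_ge0; last by rewrite mulr_ge0 ?sqr_ge0.
rewrite addr_ge0 ?sqr_ge0 // mulr_ge0 ?sqr_ge0 // mulr_ge0 // subr_ge0.
by have := sqr_ge0 (f - g); nra.
Qed.

(** Both terms of the same decomposition vanish: [S = f * T] and [f * g = 1], and [f + g <= 2] then
    leaves only [f = g = 1]. *)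
Lemma weighted_squares_eq0 (f g S T : R) :
    0 <= f -> 0 <= g -> f + g <= 2 -> (f = 0 -> S = 0) -> (g = 0 -> T = 0) ->
    S + T != 0 -> S ^+ 2 / f + T ^+ 2 / g - 2 * S * T <= 0 ->
  [/\ f = 1, g = 1 & S = T].
Proof.
move=> f0 g0 fg fS gT ST.
have sqr_div_le0 (h X : R) : 0 <= h -> (h = 0 -> X = 0) -> X ^+ 2 / h <= 0 -> X = 0.
  move=> h0 hX le0; case: (eqVneq h 0) => [/hX //|hN0].
  have : X ^+ 2 / h == 0 by rewrite eq_le le0 divr_ge0 ?sqr_ge0.
  by rewrite mulf_eq0 invr_eq0 (negPf hN0) orbF sqrf_eq0 => /eqP.
case: (eqVneq f 0) => [fE|fN0].
  have S0 := fS fE; rewrite S0 expr0n mul0r add0r mulr0 mul0r subr0.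
  by move/(sqr_div_le0 _ _ g0 gT) => T0; move: ST; rewrite S0 T0 addr0 eqxx.
case: (eqVneq g 0) => [gE|gN0].
  have T0 := gT gE; rewrite T0 expr0n mul0r addr0 mulr0 subr0.
  by move/(sqr_div_le0 _ _ f0 fS) => S0; move: ST; rewrite S0 T0 addr0 eqxx.
have fp : 0 < f by rewrite lt_neqAle eq_sym fN0.
have gp : 0 < g by rewrite lt_neqAle eq_sym gN0.
rewrite [leLHS](_ : _ = ((g * S - f * g * T) ^+ 2 + f * g * (1 - f * g) * T ^+ 2)
   / (f * g ^+ 2)); last by field; rewrite fN0 gN0.
rewrite pmulr_lle0 ?invr_gt0 ?mulr_gt0 ?exprn_gt0 // => le0.
have fg0 : 0 < f * g by rewrite mulr_gt0.
have fg_le1 : f * g <= 1 by have := sqr_ge0 (f - g); nra.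
have sq1 := sqr_ge0 (g * S - f * g * T).
have sq2 : 0 <= f * g * (1 - f * g) * T ^+ 2.
  by rewrite mulr_ge0 ?sqr_ge0 // mulr_ge0 ?(ltW fg0) // subr_ge0.
have /eqP : (g * S - f * g * T) ^+ 2 = 0 by lra.
rewrite sqrf_eq0 -mulrA [f * _]mulrCA -mulrBr mulf_eq0 (negPf gN0) subr_eq0 /=.
move=> /eqP SfT.
have T0 : T != 0 by apply: contra_neq ST => T0; rewrite SfT T0 mulr0 addr0.
have /eqP : f * g * (1 - f * g) * T ^+ 2 = 0 by lra.
rewrite mulf_eq0 sqrf_eq0 (negPf T0) orbF mulf_eq0 (gt_eqF fg0) /= subr_eq0.
move=> /eqP fg1.
have /eqP : (f - g) ^+ 2 = 0 by have := sqr_ge0 (f - g); nra.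
rewrite sqrf_eq0 subr_eq0 => /eqP fE; have f1 : f = 1 by nra.
by split; rewrite -?fE // SfT f1 mul1r.
Qed.

Variable G : sgraph.
Implicit Types (s t : seq G) (y : G -> R).

Lemma sum_sqr_sub y s (l : R) :
  \sum_(u <- s) (y u - l) ^+ 2 =
  \sum_(u <- s) y u ^+ 2 - 2 * l * (\sum_(u <- s) y u) + (size s)%:R * l ^+ 2.
Proof.
elim: s => [|v s IH]; rewrite ?big_nil /=; first by ring.
by rewrite !big_cons IH -natr1; ring.
Qed.

(* Completing the square for the form of a clique plus isolated vertices on the
   affine space of vectors with a given sum; [l] and [h] are the coordinates of
   the minimiser on clique and isolated vertices. *)
Lemma clique_sum_energy y s (a : nat) (mu : R) :
    1 < mu -> (a <= size s)%N ->
    let f := part_weight mu a%:R (size s - a)%:R in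
    let S := \sum_(u <- s) y u in
    let l := S / (f * (a%:R + mu - 1)) in
    let h := S / (f * mu) in
  clique_sum y (take a s) + mu * \sum_(u <- s) y u ^+ 2 =
  S ^+ 2 / f + (\sum_(u <- take a s) y u - a%:R * l) ^+ 2
    + (mu - 1) * \sum_(u <- take a s) (y u - l) ^+ 2
    + mu * \sum_(u <- drop a s) (y u - h) ^+ 2.
Proof.
move=> mu1 sa f S l h.
rewrite !sum_sqr_sub size_drop (size_takel sa) /clique_sum.
have -> : \sum_(u <- s) y u ^+ 2 =
    \sum_(u <- take a s) y u ^+ 2 + \sum_(u <- drop a s) y u ^+ 2.
  by rewrite -big_cat cat_take_drop.
have SE : S = \sum_(u <- take a s) y u + \sum_(u <- drop a s) y u.
  by rewrite -big_cat cat_take_drop.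
(* Zero weight means an empty list; both sides are then 0. *)
case: (eqVneq f 0) => [f0|f0].
  have [a0 /eqP] := part_weight_eq0 mu1 f0.
  rewrite subn_eq0 a0 leqn0 size_eq0 => /eqP s0.
  by rewrite /l /h /S f0 s0 /= !big_nil !mul0r invr0; ring.
move: SE; set S1 := \sum_(u <- take a s) y u; set S2 := \sum_(u <- drop a s) y u.
move=> SE; set Q1 := \sum_(u <- take a s) _; set Q2 := \sum_(u <- drop a s) _.
have a0 : 0 <= a%:R :> R by [].
have A0 : a%:R + mu - 1 != 0 by rewrite gt_eqF //; lra.
have m0 : mu != 0 by rewrite gt_eqF //; lra.
have fE : a%:R * mu + (size s - a)%:R * (a%:R + mu - 1) = f * ((a%:R + mu - 1) * mu).
  by rewrite /f /part_weight; field; rewrite A0 m0.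
(* At the minimiser all partial derivatives agree; [S / f] is half their common value. *)
have [lE hE] : l * (a%:R + mu - 1) = S / f /\ h * mu = S / f.
  by split; rewrite /l /h; field; rewrite ?A0 ?m0 f0.
have lh : a%:R * l + (size s - a)%:R * h = S.
  rewrite /l /h [LHS](_ : _ =
    S * (a%:R * mu + (size s - a)%:R * (a%:R + mu - 1)) / (f * (a%:R + mu - 1) * mu)).
    by rewrite fE; field; rewrite A0 m0 f0.
  by field; rewrite A0 m0 f0.
have -> : S ^+ 2 / f = S * (S / f) by rewrite expr2 mulrA.
(* [e1] and [e2] evaluate the constant and mixed terms of the expanded squares; together with
   [S ^+ 2 / f] they cancel. *)
have e1 : a%:R * l * (l * (a%:R + mu - 1)) + (size s - a)%:R * h * (h * mu) = S * (S / f).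
  by rewrite lE hE -mulrDl lh.
have e2 : S1 * (l * (a%:R + mu - 1)) + S2 * (h * mu) = S * (S / f).
  by rewrite lE hE -mulrDl -SE.
lra.
Qed.

(** The clique bound replaces the edges, and the squares left by [clique_sum_energy] are dropped. *)
Lemma needs_colors_energy y s (a : nat) (mu : R) :
    1 < mu -> ascending y s -> {in s, forall u, 0 <= y u} -> needs_colors s a ->
  (\sum_(u <- s) y u) ^+ 2 / part_weight mu a%:R (size s - a)%:R
    <= edge_sum y s + mu * \sum_(u <- s) y u ^+ 2.
Proof.
move=> mu1 ys y0 sa; have /= := clique_sum_energy y mu1 (needs_colors_size sa).
set l := _ / (_ * (_ + mu - 1)); set h := _ / (_ * mu) => E.
have le_clique := clique_sum_le_edge_sum ys y0 sa.
have e1 := sqr_ge0 (\sum_(u <- take a s) y u - a%:R * l).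
have e2 : 0 <= (mu - 1) * \sum_(u <- take a s) (y u - l) ^+ 2.
  by rewrite mulr_ge0 ?sumr_ge0 // => [|u _]; rewrite ?sqr_ge0 ?subr_ge0 ?ltW.
have e3 : 0 <= mu * \sum_(u <- drop a s) (y u - h) ^+ 2.
  by rewrite mulr_ge0 ?sumr_ge0 // => [|u _]; rewrite ?sqr_ge0 //; lra.
lra.
Qed.

Lemma sum_sqr_sub_eq0 y s (l : R) :
  \sum_(u <- s) (y u - l) ^+ 2 <= 0 -> {in s, forall u, y u = l}.
Proof.
move=> le0; have /eqP : \sum_(u <- s) (y u - l) ^+ 2 = 0.
  by apply/eqP; rewrite eq_le le0 sumr_ge0 // => u _; apply: sqr_ge0.
rewrite psumr_eq0 => [/allP ys u /ys /=|u _]; last exact: sqr_ge0.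
by rewrite sqrf_eq0 subr_eq0 => /eqP.
Qed.

(** Equality kills those squares, so the weights are [l] on the lightest [a] vertices and [h] on the
    rest; [edge_sum_min_edges] then determines the edges. *)
Lemma needs_colors_energy_eq y s (a : nat) (mu : R) :
    1 < mu -> (1 < a)%N -> uniq s -> 0 < \sum_(u <- s) y u ->
    ascending y s -> {in s, forall u, 0 <= y u} -> needs_colors s a ->
    part_weight mu a%:R (size s - a)%:R = 1 ->
    edge_sum y s + mu * \sum_(u <- s) y u ^+ 2 <= (\sum_(u <- s) y u) ^+ 2 ->
  {in s, forall u, 0 < y u} /\
  {in s &, forall u w, edge u w = [&& u != w, u \in take a s & w \in take a s]}.
Proof.
move=> mu1 a1 us S0 ys y0 sa f1 le_S.
have le_clique := clique_sum_le_edge_sum ys y0 sa.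
have /= := clique_sum_energy y mu1 (needs_colors_size sa).
rewrite f1 !mul1r divr1; set l := _ / (_ + mu - 1); set h := _ / mu => E.
have e1 := sqr_ge0 (\sum_(u <- take a s) y u - a%:R * l).
have e2 : 0 <= (mu - 1) * \sum_(u <- take a s) (y u - l) ^+ 2.
  by rewrite mulr_ge0 ?sumr_ge0 // => [|u _]; rewrite ?sqr_ge0 ?subr_ge0 ?ltW.
have e3 : 0 <= mu * \sum_(u <- drop a s) (y u - h) ^+ 2.
  by rewrite mulr_ge0 ?sumr_ge0 // => [|u _]; rewrite ?sqr_ge0 //; lra.
have yl : {in take a s, forall u, y u = l}.
  by apply: sum_sqr_sub_eq0; rewrite -(@pmulr_rle0 _ (mu - 1)); lra.
have yh : {in drop a s, forall u, y u = h}.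
  by apply: sum_sqr_sub_eq0; rewrite -(@pmulr_rle0 _ mu); lra.
have a1R : 1 < a%:R :> R by rewrite ltr1n.
have l0 : 0 < l by rewrite divr_gt0 //; lra.
(* [1 < a] makes the denominator of [l] larger than that of [h]. *)
have lh : l < h by rewrite /l /h ltr_pM2l // ltf_pV2 ?posrE; lra.
split; last by apply: (edge_sum_min_edges us sa l0 lh yl yh); lra.
move=> u; rewrite -{1}(cat_take_drop a s) mem_cat => /orP[/yl->|/yh->] //.
exact: lt_trans lh.
Qed.

End Energy.

(** * Eigenvectors and their sign split *)

Section Spectrum.

Variable R : realType.

(** Turns eigenvectors, which are row vectors over an enumeration, into functions on the
    vertices. *)
Lemma eigenvalue_adjacencyP (G : sgraph) (r : R) :
  eigenvalue (adjacency R G) r <->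
  exists2 x : G -> R, (exists u, x u != 0) &
    forall u, \sum_w (edge w u)%:R * x w = r * x u.
Proof.
have sumE (x : G -> R) u :
    \sum_w (edge w u)%:R * x w =
    \sum_(i < #|G|) (edge (enum_val i) u)%:R * x (enum_val i).
  by rewrite (reindex_onto _ _ (fun w _ => enum_rankK w)) //;
    apply: eq_bigl => i; rewrite enum_valK eqxx.
split=> [/eigenvalueP[v vA v0]|[x [u xu] Ax]].
  exists (fun u => v 0 (enum_rank u)).
    have /rV0Pn[j vj] := v0; exists (enum_val j); by rewrite enum_valK.
  move=> u; rewrite sumE; have := congr1 (fun w : 'rV_#|G| => w 0 (enum_rank u)) vA.
  rewrite !mxE => <-; apply: eq_bigr => i _.
  by rewrite mxE enum_rankK enum_valK mulrC.
apply/eigenvalueP; exists (\row_j x (enum_val j)).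
  apply/rowP => j; rewrite !mxE -Ax sumE; apply: eq_bigr => i _.
  by rewrite !mxE mulrC.
by apply/rV0Pn; exists (enum_rank u); rewrite mxE enum_rankK.
Qed.

Variable G : sgraph.
Implicit Types (x : G -> R).

Definition ascending_part x (p : pred G) : seq G :=
  sort (fun u w => `|x u| <= `|x w|) (enum p).

Lemma mem_ascending_part x p u : (u \in ascending_part x p) = p u.
Proof. by rewrite mem_sort mem_enum. Qed.

Lemma ascending_part_uniq x p : uniq (ascending_part x p).
Proof. by rewrite sort_uniq enum_uniq. Qed.

Lemma ascending_partP x p : ascending (fun u => `|x u|) (ascending_part x p).
Proof.
rewrite /ascending -sorted_pairwise => [|u v w]; last exact: le_trans.
by apply: sort_sorted => u w; apply: le_total.
Qed.

Lemma sum_ascending_part x p (F : G -> R) :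
  \sum_(u <- ascending_part x p) F u = \sum_(u | p u) F u.
Proof. by rewrite (perm_big _ (permEl (perm_sort _ _))) big_enum. Qed.

(** The adjacency form at an eigenvector is [r] times the squared norm. Edges across the sign split
    count negatively; taking all cross pairs and restoring the non-edges isolates a nonnegative last
    term. *)
Lemma eigen_energy x (r mu : R) :
    (forall u, \sum_w (edge w u)%:R * x w = r * x u) ->
    let y u := `|x u| in
    let s := ascending_part x (fun u => 0 <= x u) in
    let t := ascending_part x (fun u => ~~ (0 <= x u)) in
  (r + mu) * \sum_u x u ^+ 2 =
  (edge_sum y s + mu * \sum_(u <- s) y u ^+ 2)
  + (edge_sum y t + mu * \sum_(u <- t) y u ^+ 2)
  - 2 * (\sum_(u <- s) y u) * (\sum_(u <- t) y u)
  + 2 * \sum_(u <- s) \sum_(w <- t) (1 - (edge u w)%:R) * (y u * y w).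
Proof.
move=> Ax y s t.
have splitE (F : G -> R) : \sum_u F u = \sum_(u <- s) F u + \sum_(u <- t) F u.
  by rewrite !sum_ascending_part (bigID (fun u => 0 <= x u)).
have xs u : u \in s -> x u = y u.
  by rewrite mem_ascending_part => /ger0_norm.
have xt u : u \in t -> x u = - y u.
  by rewrite mem_ascending_part -ltNge /y => /ltr0_norm->; rewrite opprK.
have form : \sum_u \sum_w (edge u w)%:R * (x u * x w) =
    edge_sum y s + edge_sum y t
      - 2 * \sum_(u <- s) \sum_(w <- t) (edge u w)%:R * (y u * y w).
  rewrite splitE.
  have -> : \sum_(u <- s) \sum_w (edge u w)%:R * (x u * x w) = edge_sum y s -
      \sum_(u <- s) \sum_(w <- t) (edge u w)%:R * (y u * y w).
    rewrite /edge_sum -sumrB; apply: eq_big_seq => u us; rewrite splitE -sumrN.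
    by congr (_ + _); apply: eq_big_seq => w ws; rewrite (xs _ us) ?(xs _ ws) // (xt _ ws); ring.
  have -> : \sum_(u <- t) \sum_w (edge u w)%:R * (x u * x w) = edge_sum y t -
      \sum_(u <- s) \sum_(w <- t) (edge u w)%:R * (y u * y w).
    rewrite [X in _ - X]exchange_big /= /edge_sum -sumrB; apply: eq_big_seq => u us.
    rewrite splitE -sumrN addrC.
    congr (_ + _); apply: eq_big_seq => w ws.
      by rewrite (xt _ us) (xt _ ws); ring.
    by rewrite (xt _ us) (xs _ ws) edge_sym; ring.
  ring.
have rayleigh : \sum_u \sum_w (edge u w)%:R * (x u * x w) = r * \sum_u x u ^+ 2.
  rewrite big_distrr /=; apply: eq_bigr => u _; rewrite expr2 mulrA -Ax.
  rewrite big_distrl /=; apply: eq_bigr => w _; rewrite edge_sym; ring.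
have sq : \sum_u x u ^+ 2 = \sum_(u <- s) y u ^+ 2 + \sum_(u <- t) y u ^+ 2.
  by rewrite splitE; congr (_ + _); apply: eq_big_seq => u us; rewrite ?(xs _ us) ?(xt _ us) ?sqrrN.
have cross : \sum_(u <- s) \sum_(w <- t) (1 - (edge u w)%:R) * (y u * y w) =
   (\sum_(u <- s) y u) * (\sum_(u <- t) y u) -
   \sum_(u <- s) \sum_(w <- t) (edge u w)%:R * (y u * y w).
  rewrite big_distrl /= -sumrB; apply: eq_bigr => u _.
  by rewrite big_distrr /= -sumrB; apply: eq_bigr => w _; ring.
rewrite mulrDl -rayleigh form cross sq; ring.
Qed.

End Spectrum.

(** * The extremal graph: recognition and eigenvalue *)

Section JoinOfCliques.

Local Notation clique_plus a p := (disjoint_union (complete a) (edgeless p)).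

(** Clique vertices come first, so a position below [a] mirrors membership in [take a]. *)
Definition clique_plus_pos (a p : nat) (v : clique_plus a p) : nat :=
  match v with inl i => i | inr j => a + j end.

Lemma clique_plus_pos_lt a p (v : clique_plus a p) : (clique_plus_pos v < a + p)%N.
Proof. by case: v => i /=; rewrite ?ltn_add2l // ltn_addr. Qed.

Lemma clique_plus_pos_inj a p : injective (@clique_plus_pos a p).
Proof.
case=> i [] j /= E; first by congr inl; apply: val_inj.
- by have := ltn_ord i; rewrite E -ltn_subRL subnn.
- by have := ltn_ord j; rewrite -E -ltn_subRL subnn.
- by congr inr; apply: val_inj; apply: (addnI E).
Qed.

Lemma edge_clique_plus a p (u v : clique_plus a p) :
  edge u v = [&& u != v, clique_plus_pos u < a & clique_plus_pos v < a]%N.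
Proof.
rewrite -(inj_eq (@clique_plus_pos_inj a p)).
case: u => i; case: v => j; rewrite /= ?ltn_ord ?andbT ?andbF //=.
- by rewrite /edge /= -ltn_subRL subnn andbF.
- by rewrite /edge /= -ltn_subRL subnn andbF.
- by rewrite /edge /= -ltn_subRL subnn andbF.
Qed.

(** Reading both lists by position maps the join injectively into [G]; the sizes agree, and the
    inverse is the isomorphism. *)
Lemma isomorphic_join_cliques (G : sgraph) (s t : seq G) (a p : nat) :
    (0 < a)%N -> uniq s -> uniq t -> (forall u, (u \in t) = (u \notin s)) ->
    size s = (a + p)%N -> size t = (a + p)%N ->
    {in s &, forall u w, edge u w = [&& u != w, u \in take a s & w \in take a s]} ->
    {in t &, forall u w, edge u w = [&& u != w, u \in take a t & w \in take a t]} ->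
    {in s & t, forall u w, edge u w} ->
  isomorphic G (join (clique_plus a p) (clique_plus a p)).
Proof.
move=> a0 us ut tE ss st es et est.
case: s a0 us tE ss es est => [/lt0n_neq0|x0 s'].
  by move=> a0 _ _ /esym/eqP; rewrite addn_eq0 (negPf a0).
set s := x0 :: s' => a0 us tE ss es est.
pose at_pos (r : seq G) (v : clique_plus a p) := nth x0 r (clique_plus_pos v).
have mem_at r v : size r = (a + p)%N -> at_pos r v \in r.
  by move=> sr; rewrite mem_nth // sr clique_plus_pos_lt.
have at_inj r u v : uniq r -> size r = (a + p)%N ->
    (at_pos r u == at_pos r v) = (u == v).
  by move=> ur sr; rewrite nth_uniq ?sr ?clique_plus_pos_lt // inj_eq //;
    apply: clique_plus_pos_inj.
have at_take r v : uniq r -> size r = (a + p)%N ->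
    (at_pos r v \in take a r) = (clique_plus_pos v < a)%N.
  move=> ur sr; rewrite in_take ?mem_at // index_uniq ?sr ?clique_plus_pos_lt //.
pose g (v : join (clique_plus a p) (clique_plus a p)) : G :=
  match v with inl w => at_pos s w | inr w => at_pos t w end.
have disj u v : at_pos s u <> at_pos t v.
  by move=> E; have := mem_at t v st; rewrite -E tE mem_at.
have g_inj : injective g.
  case=> u [] v /= E.
  - by congr inl; apply/eqP; rewrite -(at_inj s) ?E.
  - by case: (disj _ _ E).
  - by case: (disj _ _ (esym E)).
  - by congr inr; apply/eqP; rewrite -(at_inj t) ?E.
have [|f gK fK] := inj_card_bij g_inj.
  rewrite !card_sum !card_ord cardT -{1}ss -st -size_cat uniq_leq_size ?enum_uniq //.
  by move=> u _; rewrite mem_cat tE orbN.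
exists f; first by exists g.
have gE u v : edge (g u) (g v) = edge u v.
  case: u => u; case: v => v; rewrite [RHS]/edge /=.
  - by rewrite es ?mem_at // at_inj // !at_take // -edge_clique_plus.
  - by rewrite est ?mem_at.
  - by rewrite edge_sym est ?mem_at.
  - by rewrite et ?mem_at // at_inj // !at_take // -edge_clique_plus.
by move=> x y; rewrite -gE !fK.
Qed.

Lemma eigenvalue_join_cliques (R : realType) (G : sgraph) (a p : nat) (mu : R) :
    (0 < a)%N -> 1 < mu -> mu ^+ 2 = (1 + p%:R) * mu + p%:R * (a%:R - 1) ->
    isomorphic G (join (clique_plus a p) (clique_plus a p)) ->
  eigenvalue (adjacency R G) (- mu).
Proof.
move=> a0 mu1 mu_eq [f [g fK gK] fE].
(* The energy minimiser of one part, scaled to clear denominators; the eigenvector takes opposite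
   signs on the two copies. *)
pose z (v : clique_plus a p) : R :=
  match v with inl _ => mu | inr _ => a%:R + mu - 1 end.
pose x (v : join (clique_plus a p) (clique_plus a p)) : R :=
  match v with inl w => z w | inr w => - z w end.
have total : \sum_w z w = a%:R * mu + p%:R * (a%:R + mu - 1).
  by rewrite big_sumType /= !sumr_const !card_ord -(mulr_natl mu) -(mulr_natl (_ + mu - 1)).
(* [mu_eq] makes the total of [z] equal [mu * (a%:R + mu - 1)]. In the join, the other copy cancels
   this total and leaves the factor [- mu]. *)
have inner v : \sum_w (edge w v)%:R * z w = (\sum_w z w) - mu * z v.
  rewrite total big_sumType /=; case: v => i /=; last first.
    rewrite !big1 => [|j _|j _]; rewrite ?mul0r //.
    by rewrite add0r; lra.
  rewrite [X in _ + X]big1 => [|j _]; last by rewrite mul0r.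
  have -> : \sum_(j < a) (edge (inl j : clique_plus a p) (inl i))%:R * mu =
      \sum_(j < a | j != i) mu.
    rewrite [RHS]big_mkcond; apply: eq_bigr => j _; rewrite /edge /=.
    by rewrite /complete_edge; case: eqP; rewrite ?mul1r ?mul0r.
  have : \sum_(j < a) mu = mu + \sum_(j < a | j != i) mu by rewrite (bigD1 i).
  rewrite sumr_const card_ord -mulr_natl => E.
  lra.
apply/eigenvalue_adjacencyP; exists (x \o f).
  exists (g (inl (inl (Ordinal a0)))); rewrite /= gK /= gt_eqF //; lra.
move=> u; rewrite (reindex g) /=; last by exists f => ? _.
under eq_bigr => w _ do rewrite -fE !gK.
move: (f u) => v; rewrite big_sumType /=; case: v => v /=.
  under [X in _ + X]eq_bigr => w _ do rewrite mul1r.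
  by rewrite sumrN inner; lra.
under [X in X + _]eq_bigr => w _ do rewrite mul1r.
under [X in _ + X]eq_bigr => w _ do rewrite mulrN.
by rewrite sumrN inner; lra.
Qed.

End JoinOfCliques.

(** * The quadratic equation of the bound, and the theorem *)

Lemma extremal_root_spec (R : realType) (n chi : R) :
    3 <= chi -> chi + 1 <= n ->
    let mu := (n - chi + 2 + Num.sqrt ((n - chi - 2) ^+ 2 + 4 * chi * (n - chi))) / 4 in
  1 < mu /\ 4 * mu ^+ 2 - (4 + 2 * (n - chi)) * mu - (n - chi) * (chi - 2) = 0.
Proof.
move=> chi3 chin /=; set D := (n - chi - 2) ^+ 2 + _.
have D0 : 0 <= D by rewrite /D addr_ge0 ?sqr_ge0 // !mulr_ge0; lra.
have s0 := sqrtr_ge0 D; have := sqr_sqrtr D0; move: s0; set q := Num.sqrt D => s0.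
rewrite /D => qE; split; last by lra.
(* [1 < mu] amounts to [2 - (n - chi) < q], obtained by comparing squares. *)
have q2 : (2 - (n - chi)) ^+ 2 < q ^+ 2 by nra.
by nra.
Qed.

Theorem theorem3p1 (R : realType) (G : sgraph) (n chi : nat) (lambda_n : R)
    (order_G : #|G| = n) (chi_G : chromatic_number G = chi)
    (chi_bounds : (3 <= chi <= n - 1)%N)
    (lambda_G : least_eigenvalue (adjacency R G) lambda_n) :
  let bound : R :=
    - ((n%:R - chi%:R + 2
        + Num.sqrt ((n%:R - chi%:R - 2) ^+ 2 + 4 * chi%:R * (n%:R - chi%:R)))
       / 4) in
  bound <= lambda_n /\
  (lambda_n = bound <->
   [/\ ~~ odd n, ~~ odd chi &
     let H := disjoint_union (complete (chi %/ 2)) (edgeless ((n - chi) %/ 2)) in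
     isomorphic G (join H H)]).
Proof.
have [chi3 chin] := andP chi_bounds.
have chi_lt : (chi + 1 <= n)%N by lia.
have half_chi : (0 < chi %/ 2)%N by lia.
have even_chi : ~~ odd chi -> (2 * (chi %/ 2))%N = chi by lia.
have even_diff : ~~ odd n -> ~~ odd chi -> (2 * ((n - chi) %/ 2))%N = (n - chi)%N.
  by lia.
(* Parity and halving for the equality case, where both parts have the same shape. *)
have balanced a p q : (a + a = chi)%N -> (a <= p)%N -> (a <= q)%N ->
    (p + q)%N = n -> (p - a = q - a)%N ->
    [/\ ~~ odd n, ~~ odd chi, chi %/ 2 = a & (n - chi) %/ 2 = p - a]%N /\
      (p = a + (p - a) /\ q = a + (p - a))%N.
  by move=> *; do !split; lia.
have chi3R : 3 <= chi%:R :> R by rewrite ler_nat.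
have chi_ltR : chi%:R + 1 <= n%:R :> R by rewrite natr1 ler_nat -addn1.
have /= := extremal_root_spec chi3R chi_ltR.
set mu := _ / 4 => -[mu1 mu_eq].
have [/eigenvalue_adjacencyP[x [u0 xu0] Ax] least] := lambda_G.
have := eigen_energy mu Ax; set y := (fun u => `|x u|).
set s := ascending_part _ _; set t := ascending_part _ (fun _ => ~~ _) => /= energy.
have tE u : (u \in t) = (u \notin s) by rewrite !mem_ascending_part.
have st u : (u \in s) || (u \in t) by rewrite tE orbN.
have [us ut] : uniq s /\ uniq t by split; apply: ascending_part_uniq.
have [a [b [ab sa tb]]] := needs_colors_split st.
have [sza szb] := (needs_colors_size sa, needs_colors_size tb).
have szn : (size s + size t)%N = n.
  rewrite -size_cat -order_G cardT; apply: perm_size; apply: uniq_perm.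
  - rewrite cat_uniq us ut andbT /=; apply/hasPn => u; by rewrite tE.
  - exact: enum_uniq.
  - by move=> u; rewrite mem_cat st mem_enum.
have [abR pqR] : a%:R + b%:R = chi%:R :> R /\
    (size s - a)%:R + (size t - b)%:R = n%:R - chi%:R :> R.
  rewrite -chi_G -ab natrD; split=> //.
  rewrite -szn !natrB // natrD; ring.
have [a0 b0] : 0 <= a%:R :> R /\ 0 <= b%:R :> R by [].
have := @part_weightD R mu a%:R b%:R (size s - a)%:R (size t - b)%:R mu1 a0 b0.
rewrite abR pqR => /(_ mu_eq) fgE.
have y0 (r : seq G) : {in r, forall u, 0 <= y u} by move=> u _; apply: normr_ge0.
have [ys yt] : ascending y s /\ ascending y t by split; apply: ascending_partP.
have Es := needs_colors_energy mu1 ys (y0 s) sa.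
have Et := needs_colors_energy mu1 yt (y0 t) tb.
have cross_ge0 u w : 0 <= (1 - (edge u w)%:R) * (y u * y w).
  by rewrite !mulr_ge0 ?normr_ge0 //; case: edge; rewrite ?subrr ?subr0.
have cross_sum_ge0 : 0 <= \sum_(u <- s) \sum_(w <- t) (1 - (edge u w)%:R) * (y u * y w).
  by do 2!apply: sumr_ge0 => ? _.
have f0 := part_weight_ge0 a (size s - a) mu1.
have g0 := part_weight_ge0 b (size t - b) mu1.
have sum_weight0 (r : seq G) c : (c <= size r)%N ->
    part_weight mu c%:R (size r - c)%:R = 0 -> \sum_(u <- r) y u = 0.
  move=> cr /(part_weight_eq0 mu1)[-> /eqP]; rewrite subn_eq0 leqn0 size_eq0.
  by move=> /eqP->; rewrite big_nil.
have den0 : 0 < (a%:R + mu - 1) * (b%:R + mu - 1) * (chi%:R + 2 * mu - 2).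
  by rewrite !mulr_gt0 //; lra.
have defect_ge0 : 0 <= (mu - 1) * (a%:R - b%:R) ^+ 2 /
    ((a%:R + mu - 1) * (b%:R + mu - 1) * (chi%:R + 2 * mu - 2)).
  by rewrite divr_ge0 ?(ltW den0) // mulr_ge0 ?sqr_ge0 // subr_ge0 ltW.
have fg2 : part_weight mu a%:R (size s - a)%:R +
    part_weight mu b%:R (size t - b)%:R <= 2 by lra.
have f_s := sum_weight0 _ _ sza; have g_t := sum_weight0 _ _ szb.
have squares := weighted_squares_ge0 f0 g0 fg2 f_s g_t.
have norm_gt0 : 0 < \sum_u x u ^+ 2.
  rewrite (bigD1 u0) //= ltr_pwDl ?sumr_ge0 // => [|u _]; last exact: sqr_ge0.
  by rewrite exprn_even_gt0.
(* [Es], [Et], [squares] and the missing cross edges make the right side of [energy] nonnegative. *)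
have lower : - mu <= lambda_n.
  by rewrite -subr_ge0 opprK -(pmulr_lge0 _ norm_gt0) energy; lra.
split=> //; split=> [lamE|[evn evchi iso]]; last first.
  (* In the extremal graph [- mu] is an eigenvalue, so the least one cannot exceed it. *)
  apply/eqP; rewrite eq_le lower andbT; apply: least.
  apply: (eigenvalue_join_cliques half_chi mu1 _ iso).
  have chi2 : chi%:R = 2 * (chi %/ 2)%:R :> R by rewrite -natrM even_chi.
  have d2 : n%:R - chi%:R = 2 * ((n - chi) %/ 2)%:R :> R.
    by rewrite -natrB ?(leq_trans _ chi_lt) ?addn1 // -natrM even_diff.
  (* After halving, [mu_eq] is four times the required equation. *)
  by move: mu_eq; rewrite d2 chi2; lra.
(* At the bound the energy is zero, so every inequality used for [lower] is tight. *)
have zero : (lambda_n + mu) * \sum_u x u ^+ 2 = 0 by rewrite lamE addNr mul0r.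
rewrite energy in zero.
have ST_gt0 : 0 < \sum_(u <- s) y u + \sum_(u <- t) y u.
  rewrite !sum_ascending_part -(bigID (fun u => 0 <= x u) predT) (bigD1 u0) //=.
  by apply: ltr_pwDl; rewrite ?normr_gt0 // sumr_ge0 // => *; apply: normr_ge0.
have [|f1 g1 ST] := weighted_squares_eq0 f0 g0 fg2 f_s g_t (lt0r_neq0 ST_gt0).
  by lra.
(* Weights summing to exactly 2 leave no room for the concavity defect. *)
have abE : a = b.
  have /eqP : (mu - 1) * (a%:R - b%:R) ^+ 2 /
    ((a%:R + mu - 1) * (b%:R + mu - 1) * (chi%:R + 2 * mu - 2)) = 0 by lra.
  rewrite mulf_eq0 invr_eq0 (gt_eqF den0) orbF mulf_eq0 sqrf_eq0 subr_eq0.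
  by rewrite (gt_eqF mu1) /= subr_eq0 eqr_nat => /eqP.
subst b.
(* With equal clique terms, equal weights force equal isolated terms. *)
have szE : (size s - a = size t - a)%N.
  have : part_weight mu a%:R (size s - a)%:R = part_weight mu a%:R (size t - a)%:R.
    by rewrite f1 g1.
  have m0 : mu != 0 by rewrite gt_eqF //; lra.
  by move=> /addrI /(mulIf (invr_neq0 m0))/eqP; rewrite eqr_nat => /eqP.
have a1 : (1 < a)%N.
  by move: chi3; rewrite -chi_G -ab; case: (a) => [|[]].
have [S0 T0] : 0 < \sum_(u <- s) y u /\ 0 < \sum_(u <- t) y u by split; lra.
rewrite f1 divr1 in Es; rewrite g1 divr1 in Et.
have sqST := sqr_ge0 (\sum_(u <- s) y u - \sum_(u <- t) y u).
have [|sp se] := needs_colors_energy_eq mu1 a1 us S0 ys (y0 s) sa f1; first by lra.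
have [|tp te] := needs_colors_energy_eq mu1 a1 ut T0 yt (y0 t) tb g1; first by lra.
have cross0 : \sum_(u <- s) \sum_(w <- t) (1 - (edge u w)%:R) * (y u * y w) = 0 by lra.
(* All weights are positive, so a missing cross edge would contribute to [cross0]. *)
have crossE : {in s & t, forall u w, edge u w}.
  move=> u w us' wt; move/eqP: cross0; rewrite psumr_eq0; last first.
    by move=> *; apply: sumr_ge0.
  move=> /allP/(_ _ us') /=; rewrite psumr_eq0 // => /allP/(_ _ wt) /=.
  case: (edge u w) => //; rewrite subr0 mul1r mulf_eq0.
  by rewrite (gt_eqF (sp _ us')) (gt_eqF (tp _ wt)).
have [[evn evchi -> ->] [sE tE']] := balanced _ _ _ (etrans ab chi_G) sza szb szn szE.
split=> //; exact: isomorphic_join_cliques (ltnW a1) us ut tE sE tE' se te crossE.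
Qed.
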